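(* Let $\mathfrak g=(\mathfrak s^*\oplus_\delta\mathfrak h)\rtimes_\delta\mathfrak s$ be a metric Lie algebra given by a double extension of a metric Lie algebra $\mathfrak h$ by a Lie algebra $\mathfrak s\neq\{0\}$, with $\dim\mathfrak g>2$. Then (1) $\mathfrak g$ is Einstein if and only if it is Ricci flat, and (2) $\mathfrak g$ is Bach flat if and only if $\mathrm{Ric}^2=0$.
   Context: A metric Lie algebra is a finite-dimensional real Lie algebra with a non-degenerate symmetric $\mathrm{ad}$-invariant bilinear form $\mathrm g=\langle\cdot,\cdot\rangle$ (any signature). Its curvature is $\mathrm R(X,Y)Z=-\frac14[[X,Y],Z]$, $\mathrm R(X,Y,Z,V)=\langle \mathrm R(X,Y)Z,V\rangle$, its Ricci tensor is $\mathrm{Ric}=-\frac14K$ ($K$ the Killing form), also regarded as an endomorphism via $\mathrm g$, and $\mathrm{Ric}^2$ is the square of that endomorphism. With $n$ the dimension and $\rho=\mathrm{tr}(\mathrm{Ric})$: $\mathsf P=\frac1{n-2}\left(\mathrm{Ric}-\frac{\rho}{2(n-1)}\mathrm g\right)$, $\mathrm C_{abcd}=\mathrm R_{abcd}+\mathrm g_{ac}\mathsf P_{db}-\mathrm g_{ad}\mathsf P_{cb}+\mathrm g_{bd}\mathsf P_{ca}-\mathrm g_{bc}\mathsf P_{da}$ (Weyl tensor), and the Bach tensor is $\mathrm B_{bc}=\mathsf P^{ad}\mathrm C_{abcd}$. Einstein: $\mathrm{Ric}$ is a multiple of $\mathrm g$; Ricci flat: $\mathrm{Ric}=0$; Bach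 flat: $\mathrm B=0$. Double extension: let $(\mathfrak h,\langle\cdot,\cdot\rangle_{\mathfrak h})$ be a metric Lie algebra, $\mathfrak s$ a Lie algebra with an $\mathrm{ad}$-invariant (possibly degenerate or zero) symmetric bilinear form $\mathrm b$, and $\delta:\mathfrak s\to\mathfrak{der}(\mathfrak h)\cap\mathfrak{so}(\mathfrak h)$, $S\mapsto\delta_S$, a Lie algebra homomorphism into the skew-symmetric derivations. Then $\mathfrak g=\mathfrak s^*\oplus\mathfrak h\oplus\mathfrak s$ as a vector space, with bracket $$[(\sigma,X,S),(\hat\sigma,\hat X,\hat S)]=\big(\mathrm{ad}^*_S\hat\sigma-\mathrm{ad}^*_{\hat S}\sigma+\langle\delta_\bullet(X),\hat X\rangle_{\mathfrak h},\ [X,\hat X]+\delta_S(\hat X)-\delta_{\hat S}(X),\ [S,\hat S]\big),$$ where $\mathrm{ad}^*_S\sigma=-\sigma\circ\mathrm{ad}_S$ and $\langle\delta_\bullet(X),\hat X\rangle_{\mathfrak h}\in\mathfrak s^*$ is $T\mapsto\langle\delta_T(X),\hat X\rangle_{\mathfrak h}$, and with scalar product $\langle(\sigma,X,S),(\hat\sigma,\hat X,\hat S)\rangle=\langle X,\hat X\rangle_{\mathfrak h}+\mathrm b(S,\hat S)+\sigma(\hat S)+\hat\sigma(S)$. *)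

(* Defs.v *)
From HB Require Import structures.
From mathcomp Require Import all_boot all_order all_algebra.
From mathcomp Require Import ring lra.
From mathcomp Require Import reals.

Set Implicit Arguments.
Unset Strict Implicit.
Unset Printing Implicit Defensive.

Import Order.TTheory GRing.Theory Num.Theory.
Import passmx.

Local Open Scope ring_scope.

Record lieAlgebra (R : realType) := LieAlgebra {
  lie_carrier :> vectType R;
  lie_bracket : {bilinear lie_carrier -> lie_carrier -> lie_carrier};
  lie_alternating : forall x, lie_bracket x x = 0;
  lie_jacobi : forall x y z,
    lie_bracket x (lie_bracket y z) + lie_bracket y (lie_bracket z x)
      + lie_bracket z (lie_bracket x y) = 0 }.

Notation "[| x , y |]" := (lie_bracket _ x y)
  (at level 0, x, y at level 99, format "[| x ,  y |]") : ring_scope.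

Definition ad (R : realType) (g : lieAlgebra R) (x : g) : 'End(g) :=
  linfun (lie_bracket g x).

Definition ad_invariant (R : realType) (g : lieAlgebra R)
    (f : g -> g -> R) : Prop :=
  forall x y z : g, f (ad x y) z = - f y (ad x z).

Record metricLieAlgebra (R : realType) := MetricLieAlgebra {
  metric_lie :> lieAlgebra R;
  metric : {symmetric metric_lie};
  metric_nondegenerate : nondegenerate metric;
  metric_ad_invariant : ad_invariant metric }.

Section LieTheory.
Variables (R : realType) (g : lieAlgebra R).
Implicit Types x y z : g.

Lemma adE x y : ad x y = [| x, y |].
Proof. by rewrite lfunE. Qed.

Lemma lie_bracketPl a x y z : [| a *: x + y, z |] = a *: [| x, z |] + [| y, z |].
Proof. exact: linearPl. Qed.

Lemma lie_bracketPr a x y z : [| z, a *: x + y |] = a *: [| z, x |] + [| z, y |].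
Proof. exact: linearPr. Qed.

Lemma ad_linear : linear (ad (g := g)).
Proof.
move=> a x y; apply/lfunP => z.
by rewrite add_lfunE scale_lfunE !adE linearDl linearZl_LR.
Qed.

Lemma lie_anticomm x y : [| x, y |] = - [| y, x |].
Proof.
apply/eqP; rewrite -addr_eq0; apply/eqP.
have := lie_alternating (x + y).
by rewrite linearDl !linearDr /= !lie_alternating add0r addr0.
Qed.

Lemma lie_bracketA x y z : [| [| x, y |], z |] = [| x, [| y, z |] |] - [| y, [| x, z |] |].
Proof.
rewrite (lie_anticomm _ z) (lie_anticomm x z) linearNr opprK.
by have /eqP := lie_jacobi x y z; rewrite addr_eq0 => /eqP ->.
Qed.

End LieTheory.

Section Curvature.
Variables (R : realType) (g : metricLieAlgebra R).
Implicit Types x y z v : g.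

Local Notation n := (\dim {:g}).
Local Notation e := (vbasis {:g}).
Local Notation "<< x , y >>" := (metric g x y).

Definition trace_end (f : 'End(g)) : R := \tr (mxof e e f).

Definition killing x y : R := trace_end (ad x \o ad y)%VF.

Definition curvature x y z : g := - (1 / 4) *: [| [| x, y |], z |].

Definition riemann x y z v : R := << curvature x y z, v >>.

Definition ricci x y : R := - (1 / 4) * killing x y.

(* Index expressions are evaluated in the basis e; [gram_inv i j] is g^{ij}. *)
Definition gram : 'M[R]_n := \matrix_(i, j) << e`_i, e`_j >>.
Definition gram_inv : 'M[R]_n := invmx gram.

Definition ricci_mx : 'M[R]_n := \matrix_(i, j) ricci e`_i e`_j.

(* Ric_i^j = Ric_{ik} g^{kj}, transposed with respect to the column convention
   because [hommx] acts on row vectors; see [ricci_endP]. *)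
Definition ricci_end : 'End(g) := hommx e e (ricci_mx *m gram_inv).

Definition rho : R := trace_end ricci_end.

Definition schouten x y : R :=
  1 / (n%:R - 2) * (ricci x y - rho / (2 * (n%:R - 1)) * << x, y >>).

Definition weyl a b c d : R :=
  riemann a b c d + << a, c >> * schouten d b - << a, d >> * schouten c b
    + << b, d >> * schouten c a - << b, c >> * schouten d a.

Definition schouten_mx : 'M[R]_n := \matrix_(i, j) schouten e`_i e`_j.

(* P^{ij} = g^{ik} P_{kl} g^{lj} *)
Definition schouten_up : 'M[R]_n := gram_inv *m schouten_mx *m gram_inv.

Definition bach y z : R :=
  \sum_(i < n) \sum_(j < n) schouten_up i j * weyl e`_i y z e`_j.

Definition einstein : Prop := exists c : R, forall x y, ricci x y = c * << x, y >>.

Definition ricci_flat : Prop := forall x y, ricci x y = 0.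

Definition bach_flat : Prop := forall y z, bach y z = 0.

Lemma metricC x y : << x, y >> = << y, x >>.
Proof. by rewrite hermC expr0 mul1r. Qed.

Lemma metricPl a x y z : << a *: x + y, z >> = a * << x, z >> + << y, z >>.
Proof. exact: linearPl. Qed.

Lemma metricPr a x y z : << z, a *: x + y >> = a * << z, x >> + << z, y >>.
Proof. exact: (linearPr (metric g)). Qed.

Lemma metricDl x y z : << x + y, z >> = << x, z >> + << y, z >>.
Proof. exact: linearDl. Qed.

Lemma metricNl x z : << - x, z >> = - << x, z >>.
Proof. exact: linearNl. Qed.

Lemma metricDr x y z : << z, x + y >> = << z, x >> + << z, y >>.
Proof. exact: linearDr. Qed.

Lemma metricNr x z : << z, - x >> = - << z, x >>.
Proof. exact: linearNr. Qed.

Lemma metric_bracket x y z : << [| x, y |], z >> = - << y, [| x, z |] >>.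
Proof. by rewrite -!adE; exact: metric_ad_invariant. Qed.

Lemma metric_eq0 x : (forall y, << x, y >> = 0) -> x = 0.
Proof.
move=> x0; have /eqP nd := metric_nondegenerate g.
by apply/eqP; rewrite -memv0 -nd; apply/mem_orthovP => v _.
Qed.

Lemma gram_unit : gram \in unitmx.
Proof.
rewrite -row_free_unit -kermx_eq0; apply/rowV0P => u /sub_kermxP uG.
suff u0 : vecof e u = 0.
  by apply/eqP; rewrite -(vecof_eq0 (vbasisP _)) u0.
apply: metric_eq0 => y; rewrite (coord_vbasis (memvf y)) linear_sumr big1 // => j _.
transitivity (coord e j y * (u *m gram) 0 j); last by rewrite uG mxE mulr0.
rewrite linearZr_LR /= /vecof linear_sumlz mxE; congr (_ * _).
by apply: eq_bigr => i _; rewrite linearZl_LR mxE.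
Qed.

Lemma killing_linear_r x a y z :
  killing x (a *: y + z) = a * killing x y + killing x z.
Proof.
rewrite /killing /trace_end ad_linear comp_lfunDr -comp_lfunZr.
by rewrite linearP /= linearP.
Qed.

Lemma trace_endC (f f' : 'End(g)) : trace_end (f \o f')%VF = trace_end (f' \o f)%VF.
Proof. by rewrite /trace_end !(mxof_comp _ _ (vbasisP _)) mxtrace_mulC. Qed.

Lemma ricciC x y : ricci x y = ricci y x.
Proof. by rewrite /ricci /killing trace_endC. Qed.

Lemma ricci_linear_r x a y z : ricci x (a *: y + z) = a * ricci x y + ricci x z.
Proof. by rewrite /ricci killing_linear_r mulrDr mulrCA. Qed.

Lemma ricci_sum_r m x (c : 'I_m -> R) (f : 'I_m -> g) :
  ricci x (\sum_i c i *: f i) = \sum_i c i * ricci x (f i).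
Proof.
have r0 : ricci x 0 = 0.
  by have := ricci_linear_r x (-1) 0 0; rewrite scaler0 addr0 mulN1r addNr.
elim/big_rec2: _ => [//|i u v _ <-]; exact: ricci_linear_r.
Qed.

Lemma ricci_endP x y : << ricci_end x, y >> = ricci x y.
Proof.
have Ee (i j : 'I_n) : << ricci_end e`_i, e`_j >> = ricci e`_i e`_j.
  rewrite /ricci_end hommxE ?vbasisP// (rVofE (vbasisP _)) -rowE.
  rewrite /vecof linear_sumlz.
  transitivity ((ricci_mx *m gram_inv *m gram) i j); last first.
    by rewrite mulmxKV ?gram_unit// mxE.
  rewrite [RHS]mxE; apply: eq_bigr => k _.
  by rewrite linearZl_LR [gram _ _]mxE [row _ _ _ _]mxE.
rewrite (coord_vbasis (memvf y)) linear_sumr ricci_sum_r; apply: eq_bigr => j _.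
rewrite linearZr /= (coord_vbasis (memvf x)) linear_sum linear_sumlz.
rewrite ricciC ricci_sum_r; congr (_ * _); apply: eq_bigr => i _.
by rewrite linearZ linearZl_LR /= Ee ricciC.
Qed.

End Curvature.

Record doubleExtensionData (R : realType) (h : metricLieAlgebra R)
    (s : lieAlgebra R) := DoubleExtensionData {
  dx_form : {symmetric s};
  dx_form_ad_invariant : ad_invariant dx_form;
  dx_der : {linear s -> 'End(h)};
  dx_derivation : forall S (X Y : h),
    dx_der S [| X, Y |] = [| dx_der S X, Y |] + [| X, dx_der S Y |];
  dx_skew : forall S (X Y : h),
    metric h (dx_der S X) Y = - metric h X (dx_der S Y);
  dx_morphism : forall S T,
    dx_der [| S, T |] = (dx_der S \o dx_der T)%VF - (dx_der T \o dx_der S)%VF }.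

Section DoubleExtension.
Variables (R : realType) (h : metricLieAlgebra R) (s : lieAlgebra R).
Variable D : doubleExtensionData h s.

Local Notation dual := 'Hom(s, R^o).
Local Notation delta := (dx_der D).
Local Notation "<< x , y >>" := (metric h x y).

(* A triple (sigma, X, S) is (u.1.1, u.1.2, u.2). *)
Local Notation ext := (dual * h * s)%type.

Definition coad (S : s) (sigma : dual) : dual := - (sigma \o ad S)%VF.

Definition dx_cocycle_fun (X Y : h) (T : s) : R^o := << delta T X, Y >>.

Fact dx_cocycle_fun_linear X Y : linear (dx_cocycle_fun X Y).
Proof.
move=> a S T; rewrite /dx_cocycle_fun linearP add_lfunE scale_lfunE.
by rewrite linearDl linearZl_LR.
Qed.

HB.instance Definition _ X Y :=
  GRing.isLinear.Build R s R^o *:%R (dx_cocycle_fun X Y)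
    (dx_cocycle_fun_linear X Y).

Definition dx_cocycle (X Y : h) : dual := linfun (dx_cocycle_fun X Y).

Definition dx_bracket (u v : ext) : ext :=
  (coad u.2 v.1.1 - coad v.2 u.1.1 + dx_cocycle u.1.2 v.1.2,
   [| u.1.2, v.1.2 |] + delta u.2 v.1.2 - delta v.2 u.1.2,
   [| u.2, v.2 |]).

Definition dx_metric (u v : ext) : R :=
  << u.1.2, v.1.2 >> + dx_form D u.2 v.2 + u.1.1 v.2 + v.1.1 u.2.

Lemma coadE S sigma T : coad S sigma T = - sigma [| S, T |].
Proof. by rewrite opp_lfunE comp_lfunE adE. Qed.

Lemma dx_cocycleE X Y T : dx_cocycle X Y T = << delta T X, Y >>.
Proof. by rewrite lfunE. Qed.

Lemma dx_derE S T X :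
  delta [| S, T |] X = delta S (delta T X) - delta T (delta S X).
Proof. by rewrite dx_morphism add_lfunE opp_lfunE !comp_lfunE. Qed.

Lemma dx_cocycleC X Y : dx_cocycle X Y = - dx_cocycle Y X.
Proof.
by apply/lfunP => T; rewrite opp_lfunE !dx_cocycleE dx_skew metricC.
Qed.

Lemma dx_bracketC u v : dx_bracket u v = - dx_bracket v u.
Proof.
rewrite /dx_bracket; congr (_, _, _); last exact: lie_anticomm.
  by rewrite opprD opprB -dx_cocycleC.
by rewrite !opprD !opprK -lie_anticomm addrAC.
Qed.

Lemma dx_bracket_linear_r u : linear (dx_bracket u).
Proof.
move=> a v w; rewrite /dx_bracket; congr (_, _, _) => /=.
- apply/lfunP => T.
  rewrite !(coadE, add_lfunE, opp_lfunE, scale_lfunE, dx_cocycleE).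
  rewrite metricPr lie_bracketPl !linearP /GRing.scale /=. ring.
- rewrite lie_bracketPr !linearP add_lfunE scale_lfunE !scalerDr scalerN opprD.
  by rewrite /= [X in X + _ = _]addrACA [LHS]addrACA.
- exact: lie_bracketPr.
Qed.

Lemma dx_bracket_linear_l v : linear (dx_bracket^~ v).
Proof.
move=> a u w; rewrite dx_bracketC dx_bracket_linear_r.
by rewrite opprD -scalerN -!dx_bracketC.
Qed.

Fact dx_bracket_bilinear : bilinear_for
  (GRing.Scale.Law.clone _ _ *:%R _) (GRing.Scale.Law.clone _ _ *:%R _)
  dx_bracket.
Proof. by split=> u; [exact: dx_bracket_linear_l | exact: dx_bracket_linear_r]. Qed.

HB.instance Definition _ :=
  bilinear_isBilinear.Build R ext ext ext _ _ dx_bracket dx_bracket_bilinear.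

Lemma dx_alternating u : dx_bracket u u = 0.
Proof.
rewrite /dx_bracket !lie_alternating add0r !subrr add0r.
suff -> : dx_cocycle u.1.2 u.1.2 = 0 by [].
apply/lfunP => T; rewrite dx_cocycleE zero_lfunE.
have := dx_skew D T u.1.2 u.1.2; rewrite [in X in - X]metricC; lra.
Qed.

Lemma dx_metric_der_bracket S T X Y :
  << delta [| S, T |] X, Y >> = << delta S X, delta T Y >> - << delta T X, delta S Y >>.
Proof.
rewrite dx_derE metricDl metricNl [<< delta S (delta T X), _ >>]dx_skew.
by rewrite [<< delta T (delta S X), _ >>]dx_skew opprK addrC.
Qed.

Lemma dx_metric_cyclic T X Y Z :
  << delta T X, [| Y, Z |] >> + << delta T Y, [| Z, X |] >>
    + << delta T Z, [| X, Y |] >> = 0.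
Proof.
rewrite [<< delta T X, _ >>]dx_skew dx_derivation metricDr.
rewrite (lie_anticomm _ Z) metricNr.
have := metric_bracket Z X (delta T Y).
have := metric_bracket Y X (delta T Z).
rewrite (lie_anticomm Y X) metricNl.
have := metricC [| Z, X |] (delta T Y).
have := metricC [| X, Y |] (delta T Z).
lra.
Qed.

Lemma dx_jacobi u v w :
  dx_bracket u (dx_bracket v w) + dx_bracket v (dx_bracket w u)
    + dx_bracket w (dx_bracket u v) = 0.
Proof.
case: u v w => [[sA X] A] [[sB Y] B] [[sC Z] C].
rewrite /dx_bracket; congr (_, _, _) => /=; last exact: lie_jacobi.
- apply/lfunP => T.
  rewrite !(coadE, add_lfunE, opp_lfunE, zero_lfunE, dx_cocycleE, lie_bracketA).
  rewrite !(linearB, metricDr, metricNr, dx_metric_der_bracket) /=.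
  have := dx_metric_cyclic T X Y Z.
  have := metricC (delta A Y) (delta T Z).
  have := metricC (delta B Z) (delta T X).
  have := metricC (delta C X) (delta T Y).
  lra.
- apply: metric_eq0 => W.
  rewrite !(linearDr, linearNr, linearB, linearD, dx_derE) /=.
  rewrite !(dx_derivation, metricDl, metricNl).
  have := congr1 (fun V => << V, W >>) (lie_jacobi X Y Z).
  rewrite !metricDl [<< 0, W >>]linear0l.
  rewrite [[| delta B Z, X |]]lie_anticomm.
  rewrite [[| delta C X, Y |]]lie_anticomm.
  rewrite [[| delta A Y, Z |]]lie_anticomm !metricNl.
  lra.
Qed.

Fact dx_metric_bilinear : bilinear_for
  (GRing.Scale.Law.clone _ _ *%R _) (GRing.Scale.Law.clone _ _ (idfun \; *%R) _)
  dx_metric.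
Proof.
split=> u a v w; rewrite /dx_metric /= !(add_lfunE, scale_lfunE) /=.
  by rewrite metricPl linearPl linearP /= /GRing.scale /=; ring.
by rewrite metricPr linearPr linearP /= /GRing.scale /=; ring.
Qed.

HB.instance Definition _ :=
  bilinear_isBilinear.Build R ext ext R _ _ dx_metric dx_metric_bilinear.

Fact dx_metric_sym u v : dx_metric u v = (-1) ^+ false * idfun (dx_metric v u).
Proof.
rewrite expr0 mul1r /dx_metric /= metricC.
rewrite [dx_form D _ _]hermC expr0 mul1r /=; ring.
Qed.

HB.instance Definition _ :=
  isHermitianSesquilinear.Build R ext false idfun dx_metric dx_metric_sym.

Definition dx_lie : lieAlgebra R :=
  @LieAlgebra R ext dx_bracket dx_alternating dx_jacobi.

Fact dx_nondegenerate : nondegenerate (dx_metric : {symmetric dx_lie}).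
Proof.
rewrite /nondegenerate -subv0; apply/subvP => -[[sA X] A] /mem_orthovP u0.
have {}u0 (v : ext) : dx_metric (sA, X, A) v = 0 by apply: u0; rewrite memvf.
have A0 : A = 0.
  rewrite (coord_vbasis (memvf A)) big1 // => i _.
  have := u0 (linfun (coord (vbasis fullv) i : s -> R^o), 0, 0).
  rewrite /dx_metric /= lfunE /= [<< X, 0 >>]linear0r [dx_form D A 0]linear0r.
  by rewrite linear0 !add0r => ->; rewrite scale0r.
have X0 : X = 0.
  apply: metric_eq0 => Y; have := u0 (0, Y, 0).
  by rewrite /dx_metric /= [dx_form D A 0]linear0r linear0 zero_lfunE !addr0.
have sA0 : sA = 0.
  apply/lfunP => T; have := u0 (0, 0, T).
  rewrite /dx_metric /= A0 [<< X, 0 >>]linear0r [dx_form D 0 T]linear0l.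
  by rewrite !zero_lfunE !add0r addr0.
by rewrite A0 X0 sA0 mem0v.
Qed.

Fact dx_ad_invariant : @ad_invariant R dx_lie dx_metric.
Proof.
move=> [[sA X] A] [[sB Y] B] [[sC Z] C]; rewrite !adE /= /dx_bracket /dx_metric /=.
rewrite !(coadE, add_lfunE, opp_lfunE, dx_cocycleE, metricDl, metricNl).
rewrite !(metricDr, metricNr) (lie_anticomm C B) [sA (- _)]linearN /=.
have := dx_form_ad_invariant D A B C; rewrite !adE.
have := metric_bracket X Y Z.
have := dx_skew D A Y Z.
have := metricC Y (delta C X).
lra.
Qed.

Definition double_extension : metricLieAlgebra R :=
  @MetricLieAlgebra R dx_lie dx_metric dx_nondegenerate dx_ad_invariant.

End DoubleExtension.

(* Main.v *)
(* Write r for the Ricci endomorphism. For a metric Lie algebra r commutes with the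
   adjoint representation, which turns the contraction defining the Bach tensor into
   traces and gives
     (n - 2)^2 B = n r^2 - n/(n-1) rho r + (rho^2/(n-1) - tr(r^2)) g.
   In a double extension s^* is an abelian ideal, so r kills s^*, which is totally
   isotropic. Evaluating at a nonzero vector x of s^*: an Einstein constant must
   vanish, and if B = 0 then so does the last coefficient, whence r^2 = l r with
   l = rho/(n-1). Then rho = tr r = l rank(r); if l were nonzero, r would have rank
   n - 1, but x and the image of r are independent and both lie in the hyperplane
   orthogonal to x. Hence l = 0 and r^2 = 0. Conversely r^2 = 0 forces rho = 0, so
   all three terms vanish. *)
Require Import Defs.
From mathcomp Require Import all_boot all_order all_algebra.
From mathcomp Require Import reals.
From HB Require Import structures.
From mathcomp Require Import ring.

Import GRing.Theory Num.Theory passmx.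

Local Open Scope ring_scope.

(** * Matrices satisfying [A *m A = l *: A] *)

(** Factor [A = col_base A *m row_base A]; cancelling the outer full-rank factors in the hypothesis
    leaves [row_base A *m col_base A = l%:M], a scalar matrix of size [\rank A]. *)
Lemma mxtrace_quasi_idempotent (F : fieldType) m (A : 'M[F]_m) (l : F) :
  A *m A = l *: A -> \tr A = l * (\rank A)%:R.
Proof.
move=> A2; rewrite mulr_natr -mxtrace_scalar.
suff <- : row_base A *m col_base A = l%:M by rewrite mxtrace_mulC mulmx_base.
apply: (row_full_inj (col_base_full A)); apply: (row_free_inj (row_base_free A)) => /=.
by rewrite mul_mx_scalar -scalemxAl mulmx_base mulmxA mulmx_base -mulmxA mulmx_base.
Qed.

(** [A] acts as [l] on its row space but kills [u], so [u] adds one dimension to that space; the sum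
    lies in [kermx w], of dimension [m - 1]. *)
Lemma rank_quasi_idempotent_lt (F : fieldType) m (A : 'M[F]_m) (l : F)
    (u : 'rV_m) (w : 'cV_m) :
  l != 0 -> A *m A = l *: A -> u != 0 -> w != 0 ->
  u *m A = 0 -> A *m w = 0 -> u *m w = 0 -> ((\rank A).+1 < m)%N.
Proof.
move=> l0 A2 u0 w0 uA Aw uw.
have dis : (u :&: A = 0)%MS.
  apply/eqP; rewrite -submx0; apply/rV_subP => v.
  rewrite sub_capmx => /andP[/submxP[a va] /submxP[b vb]].
  have : l *: v = 0 by rewrite vb scalemxAr -A2 mulmxA -vb va -mulmxA uA mulmx0.
  by move/eqP; rewrite scalemx_eq0 (negPf l0) submx0.
have uAw : (u + A <= kermx w)%MS.
  by rewrite addsmx_sub !sub_kermx uw Aw !eqxx.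
have rw : \rank w = 1%N by rewrite -mxrank_tr rank_rV trmx_eq0 w0.
have m_gt0 : (0 < m)%N by rewrite -rw rank_leq_row.
have := mxrankS uAw; rewrite mxrank_disjoint_sum // rank_rV u0 mxrank_ker rw.
by rewrite subn1 -ltnS prednK.
Qed.

(** * Traces and the Ricci endomorphism *)

Section MetricLieAlgebra.
Context {R : realType} {g : metricLieAlgebra R}.
Implicit Types (x y z v : g) (f : 'End(g)).

Local Notation n := (\dim {:g}).
Local Notation e := (vbasis {:g}).
Local Notation "<< x , y >>" := (metric g x y).
Local Notation r := (ricci_end g).

Lemma metricZl a x y : << a *: x, y >> = a * << x, y >>.
Proof. exact: linearZl_LR. Qed.

Lemma metric_coord x y : << x, y >> = \sum_(i < n) coord e i x * << e`_i, y >>.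
Proof.
rewrite [in LHS](coord_vbasis (memvf x)) linear_sumlz; apply: eq_bigr => i _.
by rewrite linearZl_LR.
Qed.

Lemma metric_inj x y : (forall z, << x, z >> = << y, z >>) -> x = y.
Proof.
move=> xy; apply/eqP; rewrite -subr_eq0; apply/eqP/metric_eq0 => z.
by rewrite metricDl metricNl xy subrr.
Qed.

Lemma trace_endD f f' : trace_end (f + f') = trace_end f + trace_end f'.
Proof. by rewrite /trace_end !linearD. Qed.

Lemma trace_endZ (a : R) f : trace_end (a *: f) = a * trace_end f.
Proof. by rewrite /trace_end !linearZ. Qed.

Lemma trace_endN f : trace_end (- f) = - trace_end f.
Proof. by rewrite -scaleN1r trace_endZ mulN1r. Qed.

Lemma trace_end1 : trace_end (\1%VF : 'End(g)) = n%:R.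
Proof. by rewrite /trace_end mxof1 ?mxtrace1 // (basis_free (vbasisP _)). Qed.

Lemma trace_end_sqr0 f : (f \o f)%VF = 0 -> trace_end f = 0.
Proof.
move=> f2; rewrite /trace_end -[RHS](mul0r ((\rank (mxof e e f))%:R)).
apply: mxtrace_quasi_idempotent.
by rewrite -(mxof_comp _ _ (vbasisP _)) f2 scale0r linear0.
Qed.

Section RankOne.
Variables (c v : g).

(** Weyl terms pairing the first slot with a fixed vector become such maps, whose trace is a single
    scalar product. *)
Definition rank_one_fun x : g := << x, c >> *: v.

Fact rank_one_fun_linear : linear rank_one_fun.
Proof.
by move=> a x y; rewrite /rank_one_fun metricPl scalerDl scalerA.
Qed.

HB.instance Definition _ :=
  GRing.isLinear.Build R g g *:%R rank_one_fun rank_one_fun_linear.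

Definition rank_one : 'End(g) := linfun rank_one_fun.

Lemma rank_oneE x : rank_one x = << x, c >> *: v.
Proof. by rewrite lfunE. Qed.

Lemma trace_rank_one : trace_end rank_one = << v, c >>.
Proof.
rewrite metric_coord /trace_end /mxtrace; apply: eq_bigr => i _.
by rewrite !mxE /= vecof_delta rank_oneE linearZ mulrC.
Qed.

End RankOne.

Lemma comp_rank_one f c v : (f \o rank_one c v)%VF = rank_one c (f v).
Proof. by apply/lfunP => x; rewrite comp_lfunE !rank_oneE linearZ. Qed.

Lemma mxof_gramE f (i j : 'I_n) : (mxof e e f *m gram g) i j = << f e`_i, e`_j >>.
Proof.
rewrite metric_coord mxE; apply: eq_bigr => k _.
by rewrite !mxE /= vecof_delta.
Qed.

Lemma gram_sym : (gram g)^T = gram g.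
Proof. by apply/matrixP => i j; rewrite !mxE metricC. Qed.

Lemma ricci_end_adj x y : << r x, y >> = << x, r y >>.
Proof. by rewrite ricci_endP ricciC -ricci_endP metricC. Qed.

(** Write [ad] of a bracket as a commutator and use cyclicity of the trace. *)
Lemma killing_invariant x y z : killing [| x, y |] z = - killing y [| x, z |].
Proof.
have adB u v : ad [| u, v |] = (ad u \o ad v)%VF - (ad v \o ad u)%VF :> 'End(g).
  apply/lfunP => w.
  by rewrite add_lfunE opp_lfunE !comp_lfunE !adE lie_bracketA.
rewrite /killing !adB !(comp_lfunDl, comp_lfunDr, comp_lfunNl, comp_lfunNr).
rewrite !(trace_endD, trace_endN) comp_lfunA.
rewrite [trace_end ((ad x \o ad y) \o _)%VF]trace_endC.
rewrite [trace_end (ad y \o (ad z \o _))%VF]trace_endC.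
rewrite -!comp_lfunA [trace_end (ad z \o _)%VF]trace_endC -!comp_lfunA.
ring.
Qed.

Lemma ricci_end_bracket x y : r [| x, y |] = [| x, r y |].
Proof.
apply: metric_inj => z; rewrite ricci_endP metric_bracket ricci_endP.
by rewrite /ricci killing_invariant; ring.
Qed.

Lemma ricci_end_ad x : (r \o ad x)%VF = ad (r x).
Proof.
apply/lfunP => y; rewrite comp_lfunE !adE lie_anticomm linearN /=.
by rewrite ricci_end_bracket -lie_anticomm.
Qed.

(** * Schouten and Weyl endomorphisms, and the Bach formula *)

Local Notation k := (rho g / (2 * (n%:R - 1))).

(* Locked, since rewriting with [scale_lfunE] or [metricZl] would unfold it. *)
Definition schouten_end : 'End(g) :=
  locked ((1 / (n%:R - 2)) *: (r - k *: \1%VF)).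

Local Notation p := schouten_end.

Lemma schouten_endE x : p x = (1 / (n%:R - 2)) *: (r x - k *: x).
Proof.
by rewrite /schouten_end -lock scale_lfunE add_lfunE opp_lfunE scale_lfunE id_lfunE.
Qed.

Lemma schouten_endP x y : << p x, y >> = schouten x y.
Proof.
by rewrite schouten_endE metricZl metricDl metricNl metricZl ricci_endP.
Qed.

Lemma schoutenC x y : schouten x y = schouten y x.
Proof. by rewrite /schouten ricciC metricC. Qed.

(** With [G] the Gram matrix, [schouten_up] is [G^-1 ([p] G) G^-1 = G^-1 [p]]; being symmetric, it
    turns the double sum into the trace of [[f] G G^-1 [p]]. *)
Lemma schouten_contraction f :
  \sum_(i < n) \sum_(j < n) schouten_up g i j * << f e`_i, e`_j >>
    = trace_end (p \o f)%VF.
Proof.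
have PG : schouten_mx g = mxof e e p *m gram g.
  by apply/matrixP => i j; rewrite mxof_gramE schouten_endP mxE.
have P_sym : (schouten_mx g)^T = schouten_mx g.
  by apply/matrixP => i j; rewrite !mxE schoutenC.
have U_sym : (schouten_up g)^T = schouten_up g.
  by rewrite /schouten_up !trmx_mul P_sym /gram_inv trmx_inv gram_sym mulmxA.
transitivity (\tr ((mxof e e f *m gram g) *m schouten_up g)).
  rewrite /mxtrace; apply: eq_bigr => i _; rewrite mxE; apply: eq_bigr => j _.
  by rewrite mxof_gramE mulrC -[in LHS]U_sym mxE.
rewrite /schouten_up PG /gram_inv -(mulmxA (invmx _)) (mulmxK (gram_unit g)) /trace_end.
by rewrite (mxof_comp _ _ (vbasisP _)) mulmxA mulmxK ?gram_unit.
Qed.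

(** The Weyl tensor with its middle slots fixed and the last one raised, so that [bach y z] is the
    trace of [p \o weyl_end y z]. *)
Definition weyl_end y z : 'End(g) :=
  - (1 / 4) *: (ad z \o ad y)%VF + rank_one z (p y) - schouten z y *: \1%VF
    + rank_one (p z) y - << y, z >> *: p.

Lemma weyl_endP x y z v : << weyl_end y z x, v >> = weyl x y z v.
Proof.
rewrite /weyl_end !(add_lfunE, opp_lfunE, scale_lfunE, comp_lfunE, id_lfunE).
rewrite !rank_oneE !adE !(metricDl, metricNl, metricZl) !schouten_endP.
rewrite /weyl /riemann /curvature metricZl (lie_anticomm z) (lie_anticomm y x).
rewrite [[| - _, z |]]linearNl opprK (schoutenC v y) (schoutenC v x).
by rewrite (metricC x (p z)) schouten_endP; ring.
Qed.

(* With [k = rho / (2 (n - 1))] one has [tr p = k], and ad-invariance of the Ricci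
   tensor gives [Ric^{ad} R_{abcd} = Ric^2_{bc}]. *)
Lemma bachE y z : n%:R - 2 != 0 :> R -> n%:R - 1 != 0 :> R ->
  (n%:R - 2) ^+ 2 * bach y z =
    n%:R * << r (r y), z >> - n%:R / (n%:R - 1) * rho g * << r y, z >>
    + (rho g ^+ 2 / (n%:R - 1) - trace_end (r \o r)%VF) * << y, z >>.
Proof.
move=> n2 n1.
have -> : bach y z = trace_end (p \o weyl_end y z)%VF.
  rewrite -schouten_contraction; apply: eq_bigr => i _; apply: eq_bigr => j _.
  by rewrite weyl_endP.
have tr_ad : trace_end (ad z \o ad y)%VF = - 4 * << r z, y >>.
  by rewrite ricci_endP /ricci /killing; field.
(* Since [r \o ad z = ad (r z)], this is the Killing form of [r z] and [y]. *)
have tr_rad : trace_end (r \o (ad z \o ad y))%VF = - 4 * << r (r z), y >>.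
  by rewrite comp_lfunA ricci_end_ad ricci_endP /ricci /killing; field.
have tr_p : trace_end p = (rho g - k * n%:R) / (n%:R - 2).
  rewrite /schouten_end -lock.
  by rewrite trace_endZ trace_endD trace_endN trace_endZ trace_end1 /rho div1r mulrC.
have tr_pf f : trace_end (p \o f)%VF
    = (trace_end (r \o f)%VF - k * trace_end f) / (n%:R - 2).
  rewrite /schouten_end -lock -comp_lfunZl trace_endZ comp_lfunDl comp_lfunNl.
  by rewrite trace_endD trace_endN -comp_lfunZl trace_endZ comp_lfun1l div1r mulrC.
have tr_rp : trace_end (r \o p)%VF = (trace_end (r \o r)%VF - k * rho g) / (n%:R - 2).
  by rewrite trace_endC tr_pf.
rewrite /weyl_end !(comp_lfunDr, comp_lfunNr) -!comp_lfunZr !comp_rank_one comp_lfun1r.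
rewrite !(trace_endD, trace_endN, trace_endZ) !trace_rank_one !tr_pf tr_rp tr_p.
rewrite tr_ad tr_rad -schouten_endP (metricC _ (p z)) !schouten_endE.
rewrite !(linearZ, linearB) /=.
rewrite !(metricDl, metricNl, metricZl, metricC (_ *: _), metricC (_ + _), metricC (- _)).
rewrite -(ricci_end_adj z y) -(ricci_end_adj (r z)) (metricC z y).
rewrite !(ricci_end_adj _ y) !(metricC z) ?(metricC (r z)) -?ricci_end_adj.
(* Every pairing is now one of three scalars; abstracting them leaves a rational identity. *)
move: n%:R n1 n2 (rho g) (trace_end _) << y, z >> << r y, z >> << r (r y), z >>.
move=> N n1 n2 rh t a b c.
by field; rewrite n1 n2.
Qed.

(** [ad x \o ad y] squares to zero: [ad x] maps into [I], [ad y] preserves [I], and the second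
    [ad x] kills [I]. *)
Lemma killing_abelian_ideal (I : g -> Prop) x y :
  (forall u v, I v -> I [| u, v |]) -> (forall u v, I u -> I v -> [| u, v |] = 0) ->
  I x -> killing x y = 0.
Proof.
move=> Iideal Iabel Ix; apply: trace_end_sqr0; apply/lfunP => z.
rewrite !comp_lfunE !adE zero_lfunE (lie_anticomm x [| y, z |]).
rewrite (linearNr _ y) (linearNr _ x) /= Iabel ?oppr0 //.
exact/Iideal/Iideal.
Qed.

(** * Consequences of a null vector killed by the Ricci endomorphism *)

Section NullVector.
Variable x : g.
Hypotheses (x_neq0 : x != 0) (x_null : << x, x >> = 0) (ricci_x : r x = 0).

Lemma einstein_ricci_flat : einstein g <-> ricci_flat g.
Proof.
split=> [[c gc] | flat]; last by exists 0 => y z; rewrite flat mul0r.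
suff c0 : c = 0 by move=> y z; rewrite gc c0 mul0r.
have /eqP : c *: x = 0.
  by apply: metric_eq0 => y; rewrite metricZl -gc -ricci_endP ricci_x linear0l.
by rewrite scaler_eq0 (negPf x_neq0) orbF => /eqP.
Qed.

(* [x] is orthogonal both to itself and to the image of [r]; it is not in that image,
   on which [r] acts as the nonzero scalar [l]. *)
Lemma rank_ricci_lt (l : R) : l != 0 -> (r \o r)%VF = l *: r ->
  ((\rank (mxof e e r)).+1 < n)%N.
Proof.
move=> l0 r2.
apply: (@rank_quasi_idempotent_lt _ _ _ l (rVof e x) (\col_i << e`_i, x >>)) => //.
- by rewrite -(mxof_comp _ _ (vbasisP _)) r2 linearZ.
- by rewrite rVof_eq0 ?vbasisP.
- apply: contraNneq x_neq0 => /matrixP w0; apply/eqP/metric_eq0 => y.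
  rewrite metricC metric_coord big1 // => i _.
  by have := w0 i 0; rewrite !mxE => ->; rewrite mulr0.
- by rewrite -rVof_app ?vbasisP // ricci_x linear0.
- apply/matrixP => i j; rewrite !mxE.
  transitivity << r e`_i, x >>; last by rewrite ricci_end_adj ricci_x linear0r.
  rewrite metric_coord; apply: eq_bigr => k _.
  by rewrite !mxE /= vecof_delta.
- apply/matrixP => i j; rewrite !mxE -[RHS]x_null metric_coord.
  by apply: eq_bigr => k _; rewrite !mxE.
Qed.

Lemma bach_flat_ricci_sqr0 : (2 < n)%N -> bach_flat g <-> (r \o r)%VF = 0.
Proof.
move=> n_gt2.
have n2 : n%:R - 2 != 0 :> R by rewrite subr_eq0 (eqr_nat R _ _) gtn_eqF.
have n1 : n%:R - 1 != 0 :> R by rewrite subr_eq0 (eqr_nat R _ 1) gtn_eqF // ltnW.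
split=> [flat | r2]; last first.
  move=> y z; have rho0 : rho g = 0 by apply: trace_end_sqr0.
  have rr0 : r (r y) = 0 by rewrite -comp_lfunE r2 zero_lfunE.
  have tr_rr : trace_end (r \o r)%VF = 0 by rewrite r2 /trace_end !linear0.
  have /eqP := bachE y z n2 n1; rewrite rho0 tr_rr rr0 [<< 0, z >>]linear0l.
  rewrite expr0n !(mul0r, mulr0, subr0, addr0) mulf_eq0 expf_eq0 (negPf n2) /=.
  by move=> /eqP.
(* At [y = x] only the metric term of [bachE] survives. *)
have const0 : rho g ^+ 2 / (n%:R - 1) - trace_end (r \o r)%VF = 0.
  have /eqP : (rho g ^+ 2 / (n%:R - 1) - trace_end (r \o r)%VF) *: x = 0.
    apply: metric_eq0 => z; rewrite metricZl.
    have := bachE x z n2 n1.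
    by rewrite flat ricci_x !linear0 [<< 0, z >>]linear0l !mulr0 subr0 add0r => <-.
  by rewrite scaler_eq0 (negPf x_neq0) orbF => /eqP.
have r2 : (r \o r)%VF = (rho g / (n%:R - 1)) *: r.
  apply/lfunP => y; rewrite comp_lfunE scale_lfunE; apply: metric_inj => z.
  have n0 : n%:R != 0 :> R by rewrite pnatr_eq0 gtn_eqF // ltnW // ltnW.
  apply: (mulfI n0); rewrite metricZl; apply: subr0_eq.
  have := bachE y z n2 n1; rewrite flat const0 mulr0 mul0r addr0 => bE.
  by rewrite [RHS]bE; ring.
suff rho0 : rho g = 0 by rewrite r2 rho0 mul0r scale0r.
apply/eqP/negPn/negP => rho0.
have l0 : rho g / (n%:R - 1) != 0 by rewrite mulf_neq0 ?invr_eq0.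
have rank_lt := rank_ricci_lt _ l0 r2.
have : rho g = rho g / (n%:R - 1) * (\rank (mxof e e r))%:R.
  apply: mxtrace_quasi_idempotent.
  by rewrite -(mxof_comp _ _ (vbasisP _)) r2 linearZ.
(* Cancelling [rho g] gives rank [n - 1], against [rank_lt]. *)
rewrite mulrAC -mulrA -[X in X = _]mulr1 => /(mulfI rho0)/esym/(canRL (mulfVK n1)).
rewrite mul1r => /eqP; rewrite eq_sym subr_eq natr1 eqr_nat => nE.
by move: rank_lt; rewrite ltn_neqAle eq_sym nE.
Qed.

End NullVector.

End MetricLieAlgebra.

(** * The dual ideal of a double extension *)

Section DoubleExtension.
Context {R : realType} {h : metricLieAlgebra R} {s : lieAlgebra R}.
Variable D : doubleExtensionData h s.
Local Notation g := (double_extension D).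

Lemma dx_ricci_dual (sigma : 'Hom(s, R^o)) : ricci_end g (sigma, 0, 0) = 0.
Proof.
apply: metric_eq0 => v; rewrite ricci_endP /ricci.
(* The predicate cuts out the summand dual to [s], an abelian ideal. *)
rewrite (@killing_abelian_ideal _ g (fun u => u.1.2 = 0 /\ u.2 = 0)) ?mulr0 //.
  move=> u w [w0 w0']; rewrite /= w0 w0' !linear0 zero_lfunE.
  by rewrite addr0 subr0.
move=> [[a X] A] [[b Y] B] /= [-> ->] [-> ->]; rewrite /dx_bracket /=.
have coad0 tau : coad 0 tau = 0 :> 'Hom(s, R^o).
  apply/lfunP => T; rewrite coadE zero_lfunE [[| 0, T |]]linear0l.
  by rewrite linear0 oppr0.
rewrite !coad0 [[| _, _ |]]linear0r [[| 0, 0 |]]linear0r !linear0.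
rewrite !(subr0, addr0, add0r).
suff -> : dx_cocycle D 0 0 = 0 by [].
by apply/lfunP => T; rewrite dx_cocycleE zero_lfunE [metric h _ 0]linear0r.
Qed.

End DoubleExtension.

Theorem corollary1p1 (R : realType) (h : metricLieAlgebra R) (s : lieAlgebra R)
    (D : doubleExtensionData h s) :
  let g := double_extension D in
  (0 < \dim {:s})%N -> (2 < \dim {:g})%N ->
  (einstein g <-> ricci_flat g) /\
  (bach_flat g <-> (ricci_end g \o ricci_end g)%VF = 0).
Proof.
move=> g dim_s dim_g.
have i : 'I_(\dim {:s}) := Ordinal dim_s.
(* A coordinate functional, nonzero because it is 1 on its basis vector. *)
pose sigma : 'Hom(s, R^o) := linfun (coord (vbasis {:s}) i : s -> R^o).
have sigma_neq0 : (sigma, 0, 0) != 0 :> g.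
  apply/eqP => -[/lfunP/(_ (vbasis {:s})`_i)].
  rewrite lfunE /= coord_free ?(basis_free (vbasisP _)) // eqxx zero_lfunE.
  by move/eqP; rewrite oner_eq0.
have sigma_null : metric g (sigma, 0, 0) (sigma, 0, 0) = 0.
  rewrite /= /dx_metric /= [metric h 0 0]linear0r.
  by rewrite [dx_form D 0 0]linear0r !linear0 !addr0.
have ricci_sigma := dx_ricci_dual D sigma.
split; first exact: einstein_ricci_flat sigma_neq0 ricci_sigma.
exact: bach_flat_ricci_sqr0 sigma_neq0 sigma_null ricci_sigma dim_g.
Qed.
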